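(* Let $\mathbf{A}\in\mathbb{R}^{M\times N}$, $\mathbf{b}\in\mathbb{R}^M$, $\mathbf{c}\in\mathbb{R}^N_{>0}$, $\gamma>0$, and $\mathcal{A}=\{\mathbf{x}\in\mathbb{R}^N:\mathbf{A}\mathbf{x}\le\mathbf{b}\}$. Let $\mathbf{x}^*=\operatorname{argmin}_{\mathbf{x}\in\mathcal{A}}\mathbf{c}^T\mathbf{x}$ and assume that all entries of $\mathbf{x}^*$ are between $0$ and $B$, where $B>0$. Let $\mathbf{W}$ be the diagonal matrix with entries $\mathbf{W}_{ii}=c_i>0$ and let $\hat{\mathbf{x}}=\operatorname{argmin}_{\mathbf{x}\in\mathcal{A}}\left[\mathbf{c}^T\mathbf{x}+\frac{1}{2\gamma}\mathbf{x}^T\mathbf{W}\mathbf{x}\right]$. Then $$\mathbf{c}^T\mathbf{x}^*\le\mathbf{c}^T\hat{\mathbf{x}}\le\mathbf{c}^T\mathbf{x}^*\left(1+\frac{B}{2\gamma}\right).$$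
   Context: $\mathbb{R}^N_{>0}$ denotes vectors with all entries strictly positive; vector inequalities are entrywise. $\mathbf{x}^*$ denotes a minimizer (assumed to exist) of the linear objective over $\mathcal{A}$. *)

(* Defs.v *)
From mathcomp Require Import all_boot all_order all_algebra.
From mathcomp Require Import classical_sets reals.
Set Implicit Arguments.
Unset Strict Implicit.
Unset Printing Implicit Defensive.
Import Order.TTheory GRing.Theory Num.Theory.
Local Open Scope classical_set_scope.
Local Open Scope ring_scope.

(* Entrywise order; MathComp matrices carry no canonical order. *)
Definition vec_le (R : realType) (n : nat) (u v : 'cV[R]_n) : Prop :=
  forall i : 'I_n, u i 0 <= v i 0.

Definition vec_pos (R : realType) (n : nat) (u : 'cV[R]_n) : Prop :=
  forall i : 'I_n, 0 < u i 0.

Definition polyhedron (R : realType) (m n : nat) (A : 'M[R]_(m, n))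
    (b : 'cV[R]_m) : set 'cV[R]_n :=
  [set x | vec_le (A *m x) b].

(* The set of all minimizers: neither existence nor uniqueness is built in. *)
Definition argmin (R : realType) (T : Type) (S : set T) (f : T -> R) : set T :=
  [set x | S x /\ forall y : T, S y -> f x <= f y].

(* The (0, 0) entry identifies the 1 x 1 matrix product with a scalar. *)
Definition lin_obj (R : realType) (n : nat) (c x : 'cV[R]_n) : R :=
  (c^T *m x) 0 0.

Definition quad_form (R : realType) (n : nat) (W : 'M[R]_n) (x : 'cV[R]_n) : R :=
  (x^T *m W *m x) 0 0.

(* Main.v *)
Require Import Defs.
From mathcomp Require Import all_boot all_order all_algebra.
From mathcomp Require Import classical_sets reals.
Import Order.TTheory GRing.Theory Num.Theory.
Local Open Scope ring_scope.

(** The lower bound is the minimality of [xstar], as [xhat] is feasible.  For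
    the upper bound, write [q x] for the regularizer, the sum of the
    [c_i * x_i ^ 2].  It is nonnegative, so dropping it at [xhat] and then
    comparing the regularized objective at [xhat] and at the feasible point
    [xstar] gives
      [c^T xhat <= c^T xstar + q xstar / (2 gamma)].
    The weights of [q] are those of the linear objective, so [0 <= x_i <= B]
    gives [c_i * x_i ^ 2 <= B * (c_i * x_i)] termwise: the regularizer costs at
    [xstar] at most the fraction [B / (2 gamma)] of the linear objective
    ([quad_form_diag_le_lin_obj]). *)

Lemma lin_objE (R : realType) (n : nat) (c x : 'cV[R]_n) :
  lin_obj c x = \sum_i c i 0 * x i 0.
Proof. by rewrite /lin_obj mxE; apply: eq_bigr => i _; rewrite mxE. Qed.

Lemma quad_form_diagE (R : realType) (n : nat) (c x : 'cV[R]_n) :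
  quad_form (diag_mx c^T) x = \sum_i c i 0 * x i 0 ^+ 2.
Proof.
rewrite /quad_form mul_mx_diag mxE; apply: eq_bigr => i _.
by rewrite !mxE expr2 mulrA (mulrC (x i 0)).
Qed.

Lemma quad_form_diag_ge0 (R : realType) (n : nat) (c x : 'cV[R]_n) :
  vec_pos c -> 0 <= quad_form (diag_mx c^T) x.
Proof.
move=> c_pos; rewrite quad_form_diagE; apply: sumr_ge0 => i _.
by rewrite mulr_ge0 ?sqr_ge0 // ltW.
Qed.

(** One factor of each square is traded for its upper bound [B]; the lower
    bound [0 <= x_i] keeps the inequality's direction under multiplication by
    the other factor. *)
Lemma quad_form_diag_le_lin_obj (R : realType) (n : nat) (c x : 'cV[R]_n)
    (B : R) :
  vec_pos c -> (forall i, 0 <= x i 0 <= B) ->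
  quad_form (diag_mx c^T) x <= B * lin_obj c x.
Proof.
move=> c_pos x_bnd; rewrite quad_form_diagE lin_objE mulr_sumr.
apply: ler_sum => i _; have /andP[x_ge0 x_leB] := x_bnd i.
by rewrite [leRHS]mulrCA ler_wpM2l ?(ltW (c_pos i)) // expr2 ler_wpM2r.
Qed.

Theorem theorem2 (R : realType) (M N : nat) (A : 'M[R]_(M, N)) (b : 'cV[R]_M)
    (c : 'cV[R]_N) (gamma B : R) (W : 'M[R]_N) (xstar xhat : 'cV[R]_N)
    (c_pos : vec_pos c) (gamma_pos : 0 < gamma) (B_pos : 0 < B)
    (xstar_min : argmin (polyhedron A b) (lin_obj c) xstar)
    (xstar_bnd : forall i : 'I_N, 0 <= xstar i 0 <= B)
    (W_def : W = diag_mx c^T)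
    (xhat_min : argmin (polyhedron A b)
       (fun x : 'cV[R]_N => lin_obj c x + 1 / (2 * gamma) * quad_form W x) xhat) :
  lin_obj c xstar <= lin_obj c xhat /\
  lin_obj c xhat <= lin_obj c xstar * (1 + B / (2 * gamma)).
Proof.
have [xstar_in lin_min] := xstar_min; have [xhat_in reg_min] := xhat_min.
split; first exact: lin_min.
have k_ge0 : 0 <= 1 / (2 * gamma) by rewrite divr_ge0 // mulr_ge0 // ltW.
have reg_hat := reg_min _ xstar_in; rewrite /= W_def in reg_hat.
apply: le_trans (le_trans _ reg_hat) _.
  by rewrite lerDl mulr_ge0 ?quad_form_diag_ge0.
rewrite mulrDr mulr1 lerD2l.
have -> : lin_obj c xstar * (B / (2 * gamma))
          = 1 / (2 * gamma) * (B * lin_obj c xstar).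
  by rewrite mul1r mulrA mulrC (mulrC B).
by rewrite ler_wpM2l ?quad_form_diag_le_lin_obj.
Qed.
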